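(* Let $\mathfrak{A}$ be a residuated lattice and let $\Pi$ be a collection of prime filters of $\mathfrak{A}$. The following assertions are equivalent: (1) $(\Pi;\tau_d)$ is a $T_1$ space; (2) $(\Pi;\tau_h)$ is a $T_1$ space; (3) $\Pi$ is an antichain (with respect to inclusion). In particular, $Max(\mathfrak{A})$ and $Min(\mathfrak{A})$ are $T_1$ spaces with both the hull-kernel topology and the dual hull-kernel topology.
   Context: A residuated lattice is an algebra $\mathfrak{A}=(A;\vee,\wedge,\odot,\rightarrow,0,1)$ such that $(A;\vee,\wedge,0,1)$ is a bounded lattice, $(A;\odot,1)$ is a commutative monoid, and $(\odot,\rightarrow)$ is an adjoint pair, i.e. $x\odot y\le z$ iff $x\le y\rightarrow z$. A filter of $\mathfrak{A}$ is a non-empty subset $F\subseteq A$ such that $x,y\in F$ implies $x\odot y\in F$, and $x\in F$, $y\in A$ imply $x\vee y\in F$. A filter is proper if it is not equal to $A$. A proper filter $P$ is prime if for all filters $F_1,F_2$, $F_1\cap F_2=P$ implies $F_1=P$ or $F_2=P$. $Max(\mathfrak{A})$ is the set of maximal filters (maximal elements among proper filters; these are prime), and $Min(\mathfrak{A})$ is the set of minimal prime filters (minimal elements, under inclusion, among all prime filters). For $X\subseteq A$ let $h(X)=\{P\in\Pi\mid X\subseteq P\}$, and write $h(x)=h(\{x\})$. The hull-kernel topology $\tau_h$ on $\Pi$ is the topology whose closed sets are the sets $h(X)$, $X\subseteq A$; the sets $d(x)=\Pi\setminus h(x)$, $x\in A$, form a base of open sets of it. The dual hull-kernel topology $\tau_d$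 on $\Pi$ is the topology having $\{h(x)\mid x\in A\}$ as a base of open sets. *)

(* Defs.v *)
From HB Require Import structures.
From mathcomp Require Import all_boot all_order.
From mathcomp Require Import boolp classical_sets topology.

Set Implicit Arguments.
Unset Strict Implicit.
Unset Printing Implicit Defensive.

Import Order.TTheory.

Local Open Scope order_scope.
Local Open Scope classical_set_scope.

HB.mixin Record isResiduated d A & Order.TBLattice d A := {
  odot : A -> A -> A;
  rimp : A -> A -> A;
  odotA : associative odot;
  odotC : commutative odot;
  odot1x : left_id \top odot;
  odot_adj : forall x y z : A, (odot x y <= z) = (x <= rimp y z)
}.

#[short(type="residuatedLatticeType")]
HB.structure Definition ResiduatedLattice d :=
  {A of isResiduated d A & Order.TBLattice d A}.

Section Filters.
Context {d : Order.disp_t} {A : residuatedLatticeType d}.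
Implicit Types (F P Q M X : set A) (Pi : set (set A)).

Definition rfilter F :=
  [/\ F !=set0,
      (forall x y, F x -> F y -> F (odot x y)) &
      (forall x y, F x -> F (Order.join x y))].

Definition proper_rfilter F := rfilter F /\ F <> [set: A].

Definition prime_rfilter P :=
  proper_rfilter P /\
  forall F1 F2, rfilter F1 -> rfilter F2 -> F1 `&` F2 = P -> F1 = P \/ F2 = P.

Definition Max_rfilter : set (set A) :=
  [set M | proper_rfilter M /\
     forall F, proper_rfilter F -> M `<=` F -> F = M].

Definition Min_rfilter : set (set A) :=
  [set P | prime_rfilter P /\ forall Q, prime_rfilter Q -> Q `<=` P -> Q = P].

Definition antichain Pi := forall P Q, Pi P -> Pi Q -> P `<=` Q -> P = Q.

Lemma Max_prime : Max_rfilter `<=` prime_rfilter.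
Proof.
move=> M [Mp Mmax]; split=> // F1 F2 f1 f2 E.
have [T1|n1] := pselect (F1 = setT); last first.
  by left; apply: Mmax => //; rewrite -E; exact: subIsetl.
by right; rewrite -E T1 setTI.
Qed.

Lemma Min_prime : Min_rfilter `<=` prime_rfilter.
Proof. by move=> P []. Qed.

Lemma rfilter_up F x y : rfilter F -> F x -> x <= y -> F y.
Proof. by case=> _ _ FJ Fx /join_idPl; rewrite joinC => <-; exact: FJ. Qed.

Lemma rfilter_top F : rfilter F -> F \top.
Proof. by move=> FF; have [[x Fx] _ _] := FF; exact: rfilter_up (lex1 x). Qed.

Lemma odot_le (x x' y y' : A) : x <= x' -> y <= y' -> odot x y <= odot x' y'.
Proof.
have lel (a b c : A) : a <= b -> odot a c <= odot b c.
  by move=> ab; rewrite odot_adj (le_trans ab)// -odot_adj.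
move=> xx' yy'; apply: le_trans (lel _ _ _ xx') _.
by rewrite odotC [leRHS]odotC; exact: lel.
Qed.

Lemma odot_leW (x y w : A) : x <= w -> odot y x <= w.
Proof.
by move=> xw; rewrite -[w]odot1x; apply: odot_le => //; exact: lex1.
Qed.

Let pow (x : A) n := iter n (odot x) \top.

Let powD x m n : pow x (m + n) = odot (pow x m) (pow x n).
Proof. by elim: m => [|m IH]; rewrite /= ?odot1x// -odotA -IH. Qed.

Let adjoin P x : set A :=
  [set z | exists p n, P p /\ odot p (pow x n) <= z].

Let adjoin_filter P x : rfilter P -> rfilter (adjoin P x).
Proof.
move=> FP; have [[p0 P0] PM _] := FP; split.
- by exists p0, p0, 0%N; split=> //=; rewrite odotC odot1x.
- move=> a b [p [n [Pp pa]]] [q [m [Pq qb]]].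
  exists (odot p q), (n + m)%N; split; first exact: PM.
  rewrite powD; apply: le_trans (odot_le pa qb).
  by rewrite -!odotA [odot q _]odotA [odot q (pow _ _)]odotC -[odot (odot _ q) _]odotA.
- move=> a b [p [n [Pp pa]]]; exists p, n; split=> //.
  exact: le_trans pa (leUl _ _).
Qed.

Let adjoin_sub P x : P `<=` adjoin P x.
Proof. by move=> p Pp; exists p, 0%N; rewrite /= odotC odot1x. Qed.

Let adjoin_mem P x : rfilter P -> adjoin P x x.
Proof.
move=> FP; exists \top, 1%N; split; first exact: rfilter_top.
by rewrite odot1x /= odotC odot1x.
Qed.

Let adjoin_join P x y p n m w : rfilter P -> P (Order.join x y) -> P p ->
  odot p (pow x n) <= w -> odot p (pow y m) <= w -> P w.
Proof.
move=> FP Pxy Pp; have [_ PM _] := FP.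
have [k] := ubnP (n + m); elim: k n m w => // k IH [|n] [|m] w lek xw yw;
  rewrite /= ?[odot p \top]odotC ?odot1x in xw yw; try by apply: (rfilter_up FP Pp).
have Px : P (rimp x w).
  apply: (IH n m.+1) => //.
    by rewrite -odot_adj odotC odotA [odot x p]odotC -odotA.
  by rewrite -odot_adj odotC; exact: odot_leW.
have Py : P (rimp y w).
  apply: (IH n.+1 m) => //; first by move: lek; rewrite addnS.
    by rewrite -odot_adj odotC; exact: odot_leW.
  by rewrite -odot_adj odotC odotA [odot y p]odotC -odotA.
apply: (rfilter_up FP (PM _ _ Pxy (PM _ _ Px Py))).
rewrite odot_adj leUx -!odot_adj; apply/andP; split.
  by rewrite odotA odotC; apply: odot_leW; rewrite odotC odot_adj.
by rewrite odotA [odot y _]odotC -odotA; apply: odot_leW; rewrite odotC odot_adj.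
Qed.

Lemma prime_join P x y :
  prime_rfilter P -> P (Order.join x y) -> P x \/ P y.
Proof.
move=> [[FP _] Pprime] Pxy.
case: (Pprime (adjoin P x) (adjoin P y)).
- exact: adjoin_filter.
- exact: adjoin_filter.
- apply/seteqP; split=> [z [[p [n [Pp pz]]] [q [m [Pq qz]]]]|z Pz].
    have [_ PM _] := FP.
    apply: (@adjoin_join P x y (odot p q) n m z) => //; first exact: PM.
      by rewrite [odot p q]odotC -odotA; exact: odot_leW.
    by rewrite -odotA; exact: odot_leW.
  by split; exact: adjoin_sub.
- by move=> <-; left; exact: adjoin_mem.
- by move=> <-; right; exact: adjoin_mem.
Qed.

Definition hull Pi (X : set A) : set Pi := [set P : Pi | X `<=` val P].

End Filters.

Section Topologies.
Context {d : Order.disp_t} {A : residuatedLatticeType d}.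
Variables (Pi : set (set A)) (primePi : Pi `<=` prime_rfilter).

(* Two copies of the carrier Pi. The primality proof is an argument because
   the open sets below form a topology only for collections of prime filters. *)
Definition hk_space of Pi `<=` prime_rfilter : Type := Pi.
Definition dhk_space of Pi `<=` prime_rfilter : Type := Pi.

HB.instance Definition _ := Choice.copy (hk_space primePi) (set_type Pi).
HB.instance Definition _ := Choice.copy (dhk_space primePi) (set_type Pi).

Let prime_val (P : Pi) : prime_rfilter (val P).
Proof. by apply: primePi; rewrite -in_setE; exact: valP. Qed.

Definition hk_open : set (set (hk_space primePi)) :=
  [set U | exists X : set A, ~` U = hull X].

Let hk_openT : hk_open setT.
Proof.
exists setT; rewrite setCT; apply/seteqP; split=> // P PT.
by have [[_ +] _] := prime_val P; apply; apply/seteqP; split.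
Qed.

Let hk_openI : setI_closed hk_open.
Proof.
move=> U V [X UX] [Y VY].
exists [set z | exists x y, [/\ X x, Y y & z = Order.join x y]].
rewrite setCI UX VY; apply/seteqP; split=> P.
  have [[[_ _ PJ] _] _] := prime_val P.
  case=> [XP|YP] z [x [y [Xx Yy ->]]]; first exact/PJ/XP.
  by rewrite joinC; exact/PJ/YP.
move=> XYP; have [XP|/existsNP[x /not_implyP[Xx Px]]] := pselect (X `<=` val P).
  by left.
right=> y Yy; have Pxy : val P (Order.join x y) by apply: XYP; exists x, y.
by have [] := prime_join (prime_val P) Pxy.
Qed.

Let hk_open_bigU (I : Type) (f : I -> set (hk_space primePi)) :
  (forall i, hk_open (f i)) -> hk_open (\bigcup_i f i).
Proof.
move=> fop; exists [set x | exists2 X, X x & exists i, ~` f i = hull X].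
rewrite setC_bigcup; apply/seteqP; split=> P.
  by move=> nf x [X Xx [i fX]]; have := nf i Logic.I; rewrite fX; apply.
move=> hP i _; have [X fX] := fop i; rewrite fX => x Xx.
by apply: hP; exists X => //; exists i.
Qed.

HB.instance Definition _ := isOpenTopological.Build (hk_space primePi)
  hk_openT hk_openI hk_open_bigU.

Definition dhk_base : set (set (dhk_space primePi)) :=
  [set hull [set x] | x in [set: A]].

Let dhk_cover : \bigcup_(B in dhk_base) id B = setT.
Proof.
apply/seteqP; split=> // P _; exists (hull [set \top]); first by exists \top.
by have [[FP _] _] := prime_val P; move=> _ ->; exact: rfilter_top.
Qed.

Let dhk_join (B C : set (dhk_space primePi)) (P : dhk_space primePi) :
  dhk_base B -> dhk_base C -> id B P -> id C P ->
  exists D, [/\ dhk_base D, id D P & id D `<=` id B `&` id C].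
Proof.
move=> [x _ <-] [y _ <-] xP yP; exists (hull [set odot x y]); split.
- by exists (odot x y).
- have [[[_ PM _] _] _] := prime_val P.
  by move=> _ ->; apply: PM; [exact: xP|exact: yP].
- move=> Q xyQ; have [[FQ _] _] := prime_val Q.
  split=> _ ->; apply: (rfilter_up FQ (xyQ _ erefl)); last exact: odot_leW.
  by rewrite odotC; exact: odot_leW.
Qed.

HB.instance Definition _ := isBaseTopological.Build (dhk_space primePi)
  dhk_cover dhk_join.

Lemma hk_closedE (C : set (hk_space primePi)) :
  closed C <-> exists X : set A, C = hull X.
Proof.
have E U : open U <-> hk_open U by [].
by rewrite -openC E /hk_open /= setCK.
Qed.

Lemma dhk_openE (U : set (dhk_space primePi)) :
  open U <-> exists S : set A, U = \bigcup_(x in S) hull [set x].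
Proof.
have E : open U <-> exists2 D, D `<=` dhk_base & \bigcup_(B in D) id B = U by [].
rewrite E; split=> [[D Dbase <-]|[S ->]].
  exists [set x | D (hull [set x])]; apply/seteqP; split=> P.
    by move=> [B DB BP]; have [x _ xB] := Dbase _ DB; exists x; rewrite /= xB.
  by move=> [x Dx xP]; exists (hull [set x]).
exists [set hull [set x] | x in S]; first by move=> _ [x _ <-]; exists x.
by rewrite bigcup_image.
Qed.

End Topologies.

(* Main.v *)
(* Dual hull-kernel open sets and hull-kernel closed sets are both up-sets for
   inclusion, so in neither topology can a T1 separation hold between two
   distinct comparable filters. Conversely, when P is not included in Q, any x
   in P \ Q gives the dual open neighbourhood h(x) of P missing Q, and the
   complement of h(P) is a hull-kernel neighbourhood of Q missing P. *)
Require Import Defs.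
From mathcomp Require Import all_boot all_order.
From mathcomp Require Import boolp classical_sets topology.

Local Open Scope classical_set_scope.

Section T1Antichain.
Context {d : Order.disp_t} {A : residuatedLatticeType d}.
Implicit Types (Pi : set (set A)).

(** Restates the condition for points of the subtype, over which [accessible_space] quantifies. *)
Lemma antichain_val Pi :
  antichain Pi <-> forall P Q : Pi, val P `<=` val Q -> P = Q.
Proof.
split=> [anti P Q PQ|anti P Q PiP PiQ PQ].
  by apply: val_inj; apply: anti PQ; rewrite -in_setE; exact: valP.
exact: (congr1 val (anti (SigSub (mem_set PiP)) (SigSub (mem_set PiQ)) PQ)).
Qed.

Lemma hk_accessibleP Pi (primePi : Pi `<=` prime_rfilter) :
  accessible_space (hk_space primePi) <-> antichain Pi.
Proof.
rewrite antichain_val; split=> [T1 P Q PQ|anti P Q neqPQ].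
  (* The larger filter [Q] is the one put in [U]: the closed complement of [U] is a hull, so
     containing [P] it also contains [Q]. *)
  apply: contrapT => /eqP; rewrite eq_sym => /(T1 Q P)[U [oU]].
  have /hk_closedE[X UX] := open_closedC oU.
  rewrite !in_setE UX => UQ XP.
  have : (~` U) Q by rewrite UX; exact: subset_trans XP PQ.
  by apply.
exists (~` hull (val Q)); rewrite openC !in_setE setCK; split => //.
- by apply/hk_closedE; exists (val Q).
- by move=> /anti QP; move: neqPQ; rewrite QP eqxx.
Qed.

Lemma dhk_accessibleP Pi (primePi : Pi `<=` prime_rfilter) :
  accessible_space (dhk_space primePi) <-> antichain Pi.
Proof.
rewrite antichain_val; split=> [T1 P Q PQ|anti P Q neqPQ].
  (* Here [U] is to contain the smaller filter [P]: some basic [hull [set x]] inside [U] contains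
     [P], hence [Q]. *)
  apply: contrapT => /eqP /(T1 P Q)[U [/dhk_openE[S ->]]].
  rewrite !in_setE => -[x Sx xP]; apply; exists x => //.
  exact: subset_trans xP PQ.
have /existsNP[x /not_implyP[Px Qx]] : ~ val P `<=` val Q.
  by move=> /anti PQ; move: neqPQ; rewrite PQ eqxx.
exists (hull [set x]); rewrite !in_setE; split.
- by apply/dhk_openE; exists [set x]; rewrite bigcup_set1.
- by move=> _ ->.
- by apply: contra_not Qx; apply.
Qed.

Lemma Max_rfilter_antichain : antichain (@Max_rfilter d A).
Proof. by move=> P Q [_ Pmax] [Qproper _] /(Pmax _ Qproper). Qed.

(** Minimality of the larger filter decides here, as maximality of the smaller one does for
    [Max_rfilter]. *)
Lemma Min_rfilter_antichain : antichain (@Min_rfilter d A).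
Proof. by move=> P Q [Pprime _] [_ Qmin] /(Qmin _ Pprime). Qed.

End T1Antichain.

Theorem theorem3p13 (d : Order.disp_t) (A : residuatedLatticeType d) :
  (forall (Pi : set (set A)) (primePi : Pi `<=` prime_rfilter),
     [<-> accessible_space (dhk_space primePi);
          accessible_space (hk_space primePi);
          antichain Pi]) /\
  [/\ accessible_space (hk_space (@Max_prime d A)),
      accessible_space (dhk_space (@Max_prime d A)),
      accessible_space (hk_space (@Min_prime d A)) &
      accessible_space (dhk_space (@Min_prime d A))].
Proof.
split=> [Pi primePi|].
  by tfae; rewrite ?dhk_accessibleP ?hk_accessibleP.
by split; rewrite ?dhk_accessibleP ?hk_accessibleP;
  [exact: Max_rfilter_antichain..|exact: Min_rfilter_antichain|
   exact: Min_rfilter_antichain].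
Qed.
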